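(* Consider the displacement group $\mathsf G$ in local coordinates $(\theta,x,y)=(x_1,x_2,x_3)\in\mathbb{R}^3$ with parameter $\beta\ge0$, $\beta\ne0$, and $$a^{\mathsf T}=\begin{pmatrix}1&0&0\\0&e^{\beta\theta}&1\end{pmatrix},\qquad z^{\mathsf T}=(0,0,-g(\theta,x,y)),$$ where $g$ is a smooth nowhere vanishing function, a potential $V\in C^\infty(\mathbb{R}^3)$ and $\rho^*=\frac1ce^{-V}$. Write $A_1f=\partial_\theta f$, $A_2f=e^{\beta\theta}\partial_xf+\partial_yf$, $\mathsf Zf=-g\,\partial_yf$. For every $f\in C^\infty(\mathsf G)$ one has $$\Gamma_2(f,f)+\Gamma_2^{z,\rho^*}(f,f)=|\mathfrak{Hess}_{a,z}f|^2+\mathfrak R(\nabla f,\nabla f),\qquad \mathfrak R=\mathfrak R_{ab}^G+\mathfrak R_{zb}+\mathfrak R_{\rho^*},$$ where $$\Lambda_1^{\mathsf T}=\Big(0,\beta\partial_xf,\tfrac{\beta\partial_yf}{2},\beta\partial_xf,0,0,\tfrac{\beta\partial_yf}{2},0,-\beta\partial_\theta f\Big),\qquad \Lambda_2^{\mathsf T}=(0,0,0,0,0,0,\lambda_6,0,\lambda_9),$$ $$\lambda_6=\frac{\partial_\theta g\,\partial_yf}{g}-\frac{\beta A_2f}{g^2}-\frac{\partial_\theta g\,\partial_yf}{g},\qquad \lambda_9=\frac{A_2g\,\partial_yf}{g}+\frac{\beta\partial_\theta f}{g^2}-\frac{A_2g\,\partial_yf}{g},$$ and $$\begin{aligned}\mathfrak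 R_{ab}^G(\nabla f,\nabla f)=&\ \mathfrak R_{ab}(\nabla f,\nabla f)-\Lambda_1^{\mathsf T}Q^{\mathsf T}Q\Lambda_1-\Lambda_2^{\mathsf T}P^{\mathsf T}P\Lambda_2+D^{\mathsf T}D+E^{\mathsf T}E\\=&\ \Gamma_1(\log g,\log g)\Gamma_1^z(f,f)-\beta^2\Big(1+\frac1{g^2}\Big)\Gamma_1(f,f)+\frac{\beta^2}{2g^2}\Gamma_1^z(f,f)\\&+\beta^2e^{\beta\theta}\,\partial_xf\,A_2f+\beta e^{\beta\theta}(A_2V)\,\partial_xf\,A_1f+\beta e^{\beta\theta}\,\partial_xV\,A_2f\,A_1f\\&+\partial_\theta^2V\,|A_1f|^2+2\big(e^{\beta\theta}\partial_\theta\partial_xV+\partial_\theta\partial_yV\big)A_1f\,A_2f\\&+\big[e^{2\beta\theta}\partial_x^2V+2e^{\beta\theta}\partial_x\partial_yV+\partial_y^2V\big]|A_2f|^2-\beta e^{\beta\theta}(A_1V)\,\partial_xf\,A_2f,\end{aligned}$$ $$\begin{aligned}\mathfrak R_{zb}(\nabla f,\nabla f)=&\ \big[\partial_\theta^2g+e^{2\beta\theta}\partial_x^2g+\partial_y^2g+2e^{\beta\theta}\partial_x\partial_yg\big]\frac{|\mathsf Zf|^2}{g}-\sum_{k=1}^2\big(A_k(-g)\big)(A_kV)\,\partial_yf\,\mathsf Zf\\&-g\,\partial_\theta\partial_yV\,A_1f\,\mathsf Zf-g\big(e^{\beta\theta}\partial_x\partial_yV+\partial_y^2V\big)A_2f\,\mathsf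 Zf,\end{aligned}$$ $$\mathfrak R_{\rho^*}(\nabla f,\nabla f)=-2\sum_{l=1}^2\sum_{p,q=1}^3\alpha_{lp}\alpha_{lq}\,\partial_p\partial_q(-g)\,\partial_yf\,\mathsf Zf-2\Gamma_1(\log\rho^*,\log g)|\mathsf Zf|^2-2\Gamma_1(\log g,\log g)|\mathsf Zf|^2,$$ with $\alpha_{lp}=(a^{\mathsf T})_{lp}$.
   Context: General notation (here $n=2$, $m=1$). $a$ is a smooth $3\times2$ matrix function and $z$ a smooth $3\times1$ matrix function on $\mathbb{R}^3$. Write $\partial_p=\partial/\partial x_p$, $\alpha_{ip}=(a^{\mathsf T})_{ip}$, $\zeta_p=(z^{\mathsf T})_{1p}$; indices $i,k$ run over $\{1,2\}$ and $p,q,r,s$ over $\{1,2,3\}$; a derivative acts only on the factor immediately following it. $A_if=(a^{\mathsf T}\nabla)_if=\sum_p\alpha_{ip}\partial_pf$, $\mathsf Zf=(z^{\mathsf T}\nabla)_1f=\sum_p\zeta_p\partial_pf$. Derivatives of $\log g$ are understood as $\nabla\log g=\nabla g/g$. Generator: $Lf=\nabla\cdot(aa^{\mathsf T}\nabla f)-\langle a\otimes\nabla a,\nabla f\rangle-\langle\nabla V,aa^{\mathsf T}\nabla f\rangle$, with $(a\otimes\nabla a)_p=\sum_{k}\sum_{q}\alpha_{kp}\partial_q\alpha_{kq}$. $\rho^*=\frac1c e^{-V}$ with $c=\int e^{-V}dx<\infty$ (here $\mathrm{Vol}=1$). Gamma forms: $\Gamma_1(f,h)=\sum_iA_if\,A_ih$,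 $\Gamma_1^z(f,h)=\mathsf Zf\,\mathsf Zh$, $\Gamma_2(f,f)=\frac12[L\Gamma_1(f,f)-2\Gamma_1(Lf,f)]$, and $$\Gamma_2^{z,\rho^*}(f,f)=\tfrac12[L\Gamma_1^z(f,f)-2\Gamma_1^z(Lf,f)]+\tfrac1{\rho^*}\nabla\cdot\big(\rho^*zz^{\mathsf T}\langle\nabla f,\nabla(aa^{\mathsf T})\nabla f\rangle\big)-\tfrac1{\rho^*}\nabla\cdot\big(\rho^*aa^{\mathsf T}\langle\nabla f,\nabla(zz^{\mathsf T})\nabla f\rangle\big),$$ where $\langle\nabla f,\nabla(M)\nabla f\rangle$ denotes the vector with $p$-th component $\langle\nabla f,(\partial_pM)\nabla f\rangle$. Matrices and vectors: pairs $(p,q)$ are ordered lexicographically. $X\in\mathbb{R}^9$ has entries $X_{pq}=\partial_p\partial_qf$. $Q\in\mathbb{R}^{4\times9}$ has entries $Q_{(i,k),(p,q)}=\alpha_{ip}\alpha_{kq}$ (rows $(i,k)$ in lexicographic order). $P\in\mathbb{R}^{2\times9}$ has entries $P_{k,(p,q)}=\zeta_p\alpha_{kq}$. $D\in\mathbb{R}^4$: $D_{ik}=\sum_{p,r}\alpha_{ip}\,\partial_p\alpha_{kr}\,\partial_rf$. $E\in\mathbb{R}^2$: $E_i=\sum_{p,r}\alpha_{ip}\,\partial_p\zeta_r\,\partial_rf$. For given $\Lambda_1,\Lambda_2\in\mathbb{R}^9$, $$|\mathfrak{Hess}_{a,z}f|^2=(X+\Lambda_1)^{\mathsf T}Q^{\mathsf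 T}Q(X+\Lambda_1)+(X+\Lambda_2)^{\mathsf T}P^{\mathsf T}P(X+\Lambda_2).$$ Tensors: let $b=-\frac12aa^{\mathsf T}\nabla V$. Then $$\mathfrak R_{ab}(\nabla f,\nabla f)=\sum_{i,k}\sum_{p,q,r}\big[\alpha_{ip}\partial_p\alpha_{iq}\,\partial_q\alpha_{kr}\,\partial_rf+\alpha_{ip}\alpha_{iq}(\partial_p\partial_q\alpha_{kr})\partial_rf-\alpha_{kr}\partial_r\alpha_{ip}\,\partial_p\alpha_{iq}\,\partial_qf-\alpha_{kr}\alpha_{ip}(\partial_r\partial_p\alpha_{iq})\partial_qf\big]A_kf-2\sum_i\sum_{q,r}\big(\alpha_{iq}\partial_qb_r\,\partial_rf-b_r\partial_r\alpha_{iq}\,\partial_qf\big)A_if,$$ $$\mathfrak R_{zb}(\nabla f,\nabla f)=\sum_i\sum_{p,q,r}\big[\alpha_{ip}\partial_p\alpha_{iq}\,\partial_q\zeta_r\,\partial_rf+\alpha_{ip}\alpha_{iq}(\partial_p\partial_q\zeta_r)\partial_rf-\zeta_r\partial_r\alpha_{ip}\,\partial_p\alpha_{iq}\,\partial_qf-\zeta_r\alpha_{ip}(\partial_r\partial_p\alpha_{iq})\partial_qf\big]\mathsf Zf-2\sum_{q,r}\big(\zeta_q\partial_qb_r\,\partial_rf-b_r\partial_r\zeta_q\,\partial_qf\big)\mathsf Zf,$$ $$\begin{aligned}\mathfrak R_{\rho^*}(\nabla f,\nabla f)=&\ 2\sum_i\sum_{p,q,r,s}\big[(\partial_p\zeta_p)\zeta_q(\partial_q\alpha_{ir})\alpha_{is}+\zeta_p(\partial_p\zeta_q)(\partial_q\alpha_{ir})\alpha_{is}+\zeta_p\zeta_q(\partial_p\partial_q\alpha_{ir})\alpha_{is}+\zeta_p\zeta_q(\partial_q\alpha_{ir})(\partial_p\alpha_{is})\big]\partial_rf\,\partial_sf\\&+2\sum_i\sum_{q,r,s}(\mathsf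 Z\log\rho^* )\zeta_q(\partial_q\alpha_{ir})\alpha_{is}\,\partial_rf\,\partial_sf\\&-2\sum_i\sum_{p,q,r,s}\big[(\partial_p\alpha_{ip})\alpha_{iq}(\partial_q\zeta_r)\zeta_s+\alpha_{ip}(\partial_p\alpha_{iq})(\partial_q\zeta_r)\zeta_s+\alpha_{ip}\alpha_{iq}(\partial_p\partial_q\zeta_r)\zeta_s+\alpha_{ip}\alpha_{iq}(\partial_q\zeta_r)(\partial_p\zeta_s)\big]\partial_rf\,\partial_sf\\&-2\sum_i\sum_{q,r,s}(A_i\log\rho^* )\alpha_{iq}(\partial_q\zeta_r)\zeta_s\,\partial_rf\,\partial_sf.\end{aligned}$$ *)

(* Defs.v *)
From HB Require Import structures.
From mathcomp Require Import all_boot all_order all_algebra.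
From mathcomp Require Import mxtens.
From mathcomp Require Import all_classical all_reals all_analysis.
Set Implicit Arguments.
Unset Strict Implicit.
Unset Printing Implicit Defensive.
Import Order.TTheory GRing.Theory Num.Theory.
Import numFieldNormedType.Exports.
Local Open Scope classical_set_scope.
Local Open Scope ring_scope.

(* Indices are 0-based: coordinates 1,2,3 are 0, 1, 2 : 'I_3, and the rows
   i, k in {1,2} of a^T are 0, 1 : 'I_2. *)

Section Calculus.
Context {R : realType}.
Implicit Types (f h V rho : 'rV[R]_3 -> R) (F u v : 'rV[R]_3 -> 'cV[R]_3).

Definition pd (p : 'I_3) f : 'rV[R]_3 -> R :=
  fun x => 'D_(delta_mx 0 p) f x.

(* C^oo: every iterated partial derivative exists everywhere and is
   continuous. *)
Definition smooth f : Prop :=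
  forall s : seq 'I_3,
    continuous (foldr pd f s) /\
    forall p x, derivable (foldr pd f s) x (delta_mx 0 p).

Definition grad f : 'rV[R]_3 -> 'cV[R]_3 := fun x => \col_p pd p f x.

Definition div F : 'rV[R]_3 -> R :=
  fun x => \sum_(p < 3) pd p (fun y => F y p 0) x.

Definition dot (u v : 'cV[R]_3) : R := \sum_(p < 3) u p 0 * v p 0.

Definition mxpd (p : 'I_3) m n (M : 'rV[R]_3 -> 'M[R]_(m, n)) :
    'rV[R]_3 -> 'M[R]_(m, n) :=
  fun x => \matrix_(i, j) pd p (fun y => M y i j) x.

(* grad (log h) is read as grad h / h, so that h may take negative values. *)
Definition grad_log h : 'rV[R]_3 -> 'cV[R]_3 :=
  fun x => (h x)^-1 *: grad h x.

Definition vec3 (t : R * R * R) : 'rV[R]_3 :=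
  \row_(j < 3) [:: t.1.1; t.1.2; t.2]`_j.

Definition lebesgue3 :=
  ((@lebesgue_measure R \x @lebesgue_measure R) \x @lebesgue_measure R)%E.

Definition mass V : \bar R :=
  (\int[lebesgue3]_t (expR (- V (vec3 t)))%:E)%E.

Definition rho_star V : 'rV[R]_3 -> R :=
  fun x => (fine (mass V))^-1 * expR (- V x).

End Calculus.

Section Gamma.
Context {R : realType}.
Implicit Types (f h V rho : 'rV[R]_3 -> R) (u v b : 'rV[R]_3 -> 'cV[R]_3).
Implicit Types (a : 'rV[R]_3 -> 'M[R]_(3, 2)) (z : 'rV[R]_3 -> 'M[R]_(3, 1)).

Definition alpha a (i : 'I_2) (p : 'I_3) : 'rV[R]_3 -> R :=
  fun x => (a x)^T i p.

Definition zeta z (p : 'I_3) : 'rV[R]_3 -> R := fun x => (z x)^T 0 p.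

Definition outer m (c : 'rV[R]_3 -> 'M[R]_(3, m)) : 'rV[R]_3 -> 'M[R]_3 :=
  fun x => c x *m (c x)^T.

Definition A_vec a (i : 'I_2) u : 'rV[R]_3 -> R :=
  fun x => ((a x)^T *m u x) i 0.

Definition A a i f : 'rV[R]_3 -> R := A_vec a i (grad f).

Definition Z z f : 'rV[R]_3 -> R := fun x => ((z x)^T *m grad f x) 0 0.

Definition a_grad_a a : 'rV[R]_3 -> 'cV[R]_3 :=
  fun x => \col_p \sum_(k < 2) \sum_(q < 3)
    alpha a k p x * pd q (alpha a k q) x.

Definition L a V f : 'rV[R]_3 -> R := fun x =>
  div (fun y => outer a y *m grad f y) x
  - dot (a_grad_a a x) (grad f x)
  - dot (grad V x) (outer a x *m grad f x).

(* Gamma_1 as a bilinear form on gradients; this gives a meaning to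
   Gamma_1(log g, _) when g < 0, through grad_log g. *)
Definition Gamma1_vec a u v : 'rV[R]_3 -> R :=
  fun x => \sum_(i < 2) A_vec a i u x * A_vec a i v x.

Definition Gamma1 a f h : 'rV[R]_3 -> R := Gamma1_vec a (grad f) (grad h).

Definition Gamma1z z f h : 'rV[R]_3 -> R := fun x => Z z f x * Z z h x.

Definition Gamma2 a V f : 'rV[R]_3 -> R := fun x =>
  2^-1 * (L a V (Gamma1 a f f) x - 2 * Gamma1 a (L a V f) f x).

Definition grad_quad (M : 'rV[R]_3 -> 'M[R]_3) f : 'rV[R]_3 -> 'cV[R]_3 :=
  fun x => \col_p dot (grad f x) (mxpd p M x *m grad f x).

Definition div_rho rho u : 'rV[R]_3 -> R :=
  fun x => (rho x)^-1 * div (fun y => rho y *: u y) x.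

Definition Gamma2z a z V rho f : 'rV[R]_3 -> R := fun x =>
  2^-1 * (L a V (Gamma1z z f f) x - 2 * Gamma1z z (L a V f) f x)
  + div_rho rho (fun y => outer z y *m grad_quad (outer a) f y) x
  - div_rho rho (fun y => outer a y *m grad_quad (outer z) f y) x.

(* A pair is encoded by its rank in the lexicographic order: mxtens_unindex
   sends u : 'I_(m * n) to the pair (u %/ n, u %% n). *)
Definition Xvec f : 'rV[R]_3 -> 'cV[R]_(3 * 3) :=
  fun x => \col_u
    let pq := mxtens_unindex u in pd pq.1 (pd pq.2 f) x.

Definition Qmx a : 'rV[R]_3 -> 'M[R]_(2 * 2, 3 * 3) :=
  fun x => \matrix_(w, u)
    let ik := mxtens_unindex w in let pq := mxtens_unindex u in
    alpha a ik.1 pq.1 x * alpha a ik.2 pq.2 x.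

Definition Pmx a z : 'rV[R]_3 -> 'M[R]_(2, 3 * 3) :=
  fun x => \matrix_(k, u)
    let pq := mxtens_unindex u in zeta z pq.1 x * alpha a k pq.2 x.

Definition Dvec a f : 'rV[R]_3 -> 'cV[R]_(2 * 2) :=
  fun x => \col_w
    let ik := mxtens_unindex w in
    \sum_(p < 3) \sum_(r < 3)
      alpha a ik.1 p x * pd p (alpha a ik.2 r) x * pd r f x.

Definition Evec a z f : 'rV[R]_3 -> 'cV[R]_2 :=
  fun x => \col_i \sum_(p < 3) \sum_(r < 3)
    alpha a i p x * pd p (zeta z r) x * pd r f x.

Definition gram m n (M : 'M[R]_(m, n)) (v : 'cV[R]_n) : R :=
  (v^T *m M^T *m M *m v) 0 0.

Definition Hess2 a z (L1 L2 : 'rV[R]_3 -> 'cV[R]_(3 * 3)) f :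
    'rV[R]_3 -> R :=
  fun x => gram (Qmx a x) (Xvec f x + L1 x)
         + gram (Pmx a z x) (Xvec f x + L2 x).

Definition drift a V : 'rV[R]_3 -> 'cV[R]_3 :=
  fun x => - 2^-1 *: (outer a x *m grad V x).

Definition R_ab a V f : 'rV[R]_3 -> R := fun x =>
  let al i p := alpha a i p x in
  let dal r i p := pd r (alpha a i p) x in
  let ddal p q i r := pd p (pd q (alpha a i r)) x in
  let b r := drift a V x r 0 in
  let db q r := pd q (fun y => drift a V y r 0) x in
  let df r := pd r f x in
  \sum_(i < 2) \sum_(k < 2)
    (\sum_(p < 3) \sum_(q < 3) \sum_(r < 3)
      (al i p * dal p i q * dal q k r * df r
       + al i p * al i q * ddal p q k r * df r
       - al k r * dal r i p * dal p i q * df q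
       - al k r * al i p * ddal r p i q * df q)) * A a k f x
  - 2 * \sum_(i < 2)
    (\sum_(q < 3) \sum_(r < 3)
      (al i q * db q r * df r - b r * dal r i q * df q)) * A a i f x.

Definition R_zb a z V f : 'rV[R]_3 -> R := fun x =>
  let al i p := alpha a i p x in
  let dal r i p := pd r (alpha a i p) x in
  let ddal p q i r := pd p (pd q (alpha a i r)) x in
  let ze p := zeta z p x in
  let dze q r := pd q (zeta z r) x in
  let ddze p q r := pd p (pd q (zeta z r)) x in
  let b r := drift a V x r 0 in
  let db q r := pd q (fun y => drift a V y r 0) x in
  let df r := pd r f x in
  \sum_(i < 2)
    (\sum_(p < 3) \sum_(q < 3) \sum_(r < 3)
      (al i p * dal p i q * dze q r * df r
       + al i p * al i q * ddze p q r * df r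
       - ze r * dal r i p * dal p i q * df q
       - ze r * al i p * ddal r p i q * df q)) * Z z f x
  - 2 * (\sum_(q < 3) \sum_(r < 3)
      (ze q * db q r * df r - b r * dze r q * df q)) * Z z f x.

Definition R_rho a z rho f : 'rV[R]_3 -> R := fun x =>
  let al i p := alpha a i p x in
  let dal r i p := pd r (alpha a i p) x in
  let ddal p q i r := pd p (pd q (alpha a i r)) x in
  let ze p := zeta z p x in
  let dze q r := pd q (zeta z r) x in
  let ddze p q r := pd p (pd q (zeta z r)) x in
  let df r := pd r f x in
  let logrho := (@ln R) \o rho in
  2 * \sum_(i < 2) \sum_(p < 3) \sum_(q < 3) \sum_(r < 3) \sum_(s < 3)
      (dze p p * ze q * dal q i r * al i s
       + ze p * dze p q * dal q i r * al i s
       + ze p * ze q * ddal p q i r * al i s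
       + ze p * ze q * dal q i r * dal p i s) * df r * df s
  + 2 * \sum_(i < 2) \sum_(q < 3) \sum_(r < 3) \sum_(s < 3)
      Z z logrho x * ze q * dal q i r * al i s * df r * df s
  - 2 * \sum_(i < 2) \sum_(p < 3) \sum_(q < 3) \sum_(r < 3) \sum_(s < 3)
      (dal p i p * al i q * dze q r * ze s
       + al i p * dal p i q * dze q r * ze s
       + al i p * al i q * ddze p q r * ze s
       + al i p * al i q * dze q r * dze p s) * df r * df s
  - 2 * \sum_(i < 2) \sum_(q < 3) \sum_(r < 3) \sum_(s < 3)
      A a i logrho x * al i q * dze q r * ze s * df r * df s.

Definition R_abG a z V (L1 L2 : 'rV[R]_3 -> 'cV[R]_(3 * 3)) f :
    'rV[R]_3 -> R := fun x =>
  R_ab a V f x - gram (Qmx a x) (L1 x) - gram (Pmx a z x) (L2 x)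
  + ((Dvec a f x)^T *m Dvec a f x) 0 0 + ((Evec a z f x)^T *m Evec a z f x) 0 0.

End Gamma.

(* The coordinates (theta, x, y) are 0, 1, 2 : 'I_3. *)
Section Displacement.
Context {R : realType}.
Variable beta : R.
Implicit Types (f g : 'rV[R]_3 -> R) (x : 'rV[R]_3).

Definition theta x : R := x 0 0.

Definition dth f : 'rV[R]_3 -> R := pd 0 f.
Definition dx f : 'rV[R]_3 -> R := pd 1 f.
Definition dy f : 'rV[R]_3 -> R := pd 2 f.

Definition mx_of_rows m n (s : seq (seq R)) : 'M[R]_(m, n) :=
  \matrix_(i, j) (nth [::] s i)`_j.

Definition displ_a : 'rV[R]_3 -> 'M[R]_(3, 2) := fun x =>
  (mx_of_rows 2 3 [:: [:: 1; 0; 0];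
                      [:: 0; expR (beta * theta x); 1]])^T.

Definition displ_z g : 'rV[R]_3 -> 'M[R]_(3, 1) := fun x =>
  (mx_of_rows 1 3 [:: [:: 0; 0; - g x]])^T.

Definition Lambda1 f : 'rV[R]_3 -> 'cV[R]_(3 * 3) := fun x =>
  \col_u [:: 0; beta * dx f x; beta * dy f x / 2;
             beta * dx f x; 0; 0;
             beta * dy f x / 2; 0; - (beta * dth f x)]`_u.

Definition lambda6 g f : 'rV[R]_3 -> R := fun x =>
  dth g x * dy f x / g x - beta * A displ_a 1 f x / g x ^+ 2
  - dth g x * dy f x / g x.

Definition lambda9 g f : 'rV[R]_3 -> R := fun x =>
  A displ_a 1 g x * dy f x / g x + beta * dth f x / g x ^+ 2
  - A displ_a 1 g x * dy f x / g x.

Definition Lambda2 g f : 'rV[R]_3 -> 'cV[R]_(3 * 3) := fun x =>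
  \col_u [:: 0; 0; 0; 0; 0; 0; lambda6 g f x; 0; lambda9 g f x]`_u.

End Displacement.

(* Main.v *)
Require Import Defs.
From HB Require Import structures.
From mathcomp Require Import all_boot all_order all_algebra.
From mathcomp Require Import mxtens.
From mathcomp Require Import all_classical all_reals all_analysis.
From mathcomp Require Import measurable_realfun ring lra.
Import Order.TTheory GRing.Theory Num.Theory.
Import numFieldNormedType.Exports.
Local Open Scope classical_set_scope.
Local Open Scope ring_scope.

Set Implicit Arguments.
Unset Strict Implicit.
Unset Printing Implicit Defensive.

(* In the frame [A_1 = d_theta], [A_2 = e d_x + d_y], [e = exp (beta theta)],
   one has [L = A_1^2 + A_2^2 - (A_1 V) A_1 - (A_2 V) A_2], because each of the
   two fields has divergence zero; the carre du champ of [L] is [Gamma_1]. Hence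
   [Gamma_2] and the first half of [Gamma_2^{z,rho}] are given by
   [L A_i f - A_i L f] and [L Z f - Z L f] plus sums of squares. In the second
   half the [z z^T] divergence vanishes, because [a a^T] depends on [theta] only
   while [z] points in the [y] direction, and the [a a^T] divergence is
   [sum_i (A_i - A_i V) (2 g (A_i g) (d_y f)^2)]. With mixed partials sorted
   (Schwarz), all four claims are rational identities in the jets of [f], [g],
   [V] and in [e] at a point. The mass of [exp (- V)] has to be shown positive:
   otherwise [rho] would be the junk value [0]. *)

(** * Smooth functions on R^3: closure properties and symmetry of mixed partials *)

Section SmoothFunctions.
Context {R : realType}.
Implicit Types (f h W : 'rV[R]_3 -> R) (p q : 'I_3) (x v : 'rV[R]_3).

Lemma smooth_continuous f : smooth f -> continuous f.
Proof. by move=> /(_ [::])[]. Qed.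

Lemma smooth_derivable f p x : smooth f -> derivable f x (delta_mx 0 p).
Proof. by move=> /(_ [::])[_]; apply. Qed.

Lemma smooth_pd f p : smooth f -> smooth (pd p f).
Proof. by move=> fs s; have := fs (rcons s p); rewrite foldr_rcons. Qed.

(** Bounding the number of derivatives gives a parameter for induction: the closure of [smooth]
    under products and exponentials cannot be proved one list of derivatives at a time, since each
    derivative produces new products. *)
Definition smooth_upto n f := forall s : seq 'I_3, (size s <= n)%N ->
  continuous (foldr pd f s) /\
  forall p x, derivable (foldr pd f s) x (delta_mx 0 p).

Lemma smoothP f : smooth f <-> forall n, smooth_upto n f.
Proof.
split=> [fs n s _|fs s]; first exact: fs.
exact: (fs (size s)).
Qed.

(** The derivative peeled off is the innermost one, at the end of the list, so that the induction on
    [n] passes from [f] to [pd p f]. *)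
Lemma smooth_uptoS n f : smooth_upto n.+1 f <->
  smooth_upto 0 f /\ forall p, smooth_upto n (pd p f).
Proof.
split=> [fs|[f0 fs]].
  split=> [[|//] _|p s sn]; first exact: fs [::] _.
  by have := fs (rcons s p); rewrite foldr_rcons size_rcons; apply.
case/lastP=> [_|s p]; first exact: f0 [::] _.
by rewrite size_rcons foldr_rcons => sn; exact: fs.
Qed.

Lemma smooth_upto0 f : smooth_upto 0 f <->
  continuous f /\ forall p x, derivable f x (delta_mx 0 p).
Proof.
split=> [fs|fs s]; first exact: (fs [::] isT).
by rewrite leqn0 => /nilP ->.
Qed.

Lemma smooth_uptoW n f : smooth_upto n.+1 f -> smooth_upto n f.
Proof. by move=> fs s sn; apply: fs; exact: leqW. Qed.

Lemma pd_cst (c : R) p : pd p (fun=> c) = (fun=> 0) :> ('rV[R]_3 -> R).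
Proof. by apply/funext => x; exact: derive_cst. Qed.

Lemma pdD f h p : smooth_upto 0 f -> smooth_upto 0 h ->
  pd p (f + h) = pd p f + pd p h.
Proof.
move=> /smooth_upto0[_ fs] /smooth_upto0[_ hs].
by apply/funext => x; exact: deriveD.
Qed.

Lemma pdN f p : smooth_upto 0 f -> pd p (- f) = - pd p f.
Proof.
by move=> /smooth_upto0[_ fs]; apply/funext => x; exact: deriveN.
Qed.

Lemma pdM f h p : smooth_upto 0 f -> smooth_upto 0 h ->
  pd p (f * h) = f * pd p h + h * pd p f.
Proof.
move=> /smooth_upto0[_ fs] /smooth_upto0[_ hs].
by apply/funext => x; exact: deriveM.
Qed.

(** Only a directional derivative of [W] is given, so the chain rule is applied in one variable,
    along the line [t *: v + x]. *)
Lemma is_derive_expR_comp W x v : derivable W x v ->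
  is_derive x v (expR \o W) ('D_v W x * expR (W x)).
Proof.
pose w t := W (t *: v + x).
move=> /derivable1P dw.
have w0 : w 0 = W x by rewrite /w scale0r add0r.
have D (F : 'rV[R]_3 -> R) : 'D_v F x = 'D_1 (fun t : R => F (t *: v + x)) 0.
  rewrite /derive.
  set u := fun h : R => h^-1 *: _; set u' := fun h : R => h^-1 *: _.
  suff -> : u = u' by []; apply/funext => h; rewrite /u /u' /=.
  by rewrite addr0 scale0r add0r [_%:A]mulr1.
have dW : is_derive (0 : R) 1 w ('D_v W x) by rewrite D; split.
have dE : is_derive (w 0) 1 expR (expR (w 0)) by exact: is_derive_expR.
have [de eE] := is_derive1_comp dE dW.
split; first by apply/derivable1P; exact: de.
by rewrite D mulrC -w0; exact: eE.
Qed.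

Lemma pd_expR W p : smooth_upto 0 W ->
  pd p (expR \o W) = pd p W * (expR \o W).
Proof.
move=> /smooth_upto0[_ Ws]; apply/funext => x.
by have [_] := is_derive_expR_comp (Ws p x).
Qed.

Lemma smooth_uptoW0 n f : smooth_upto n f -> smooth_upto 0 f.
Proof. by elim: n => // n IH /smooth_uptoW. Qed.

Lemma smooth_upto_cst n (c : R) : smooth_upto n (fun=> c).
Proof.
elim: n c => [|n IH] c.
  apply/smooth_upto0; split; first exact: cst_continuous.
  by move=> p x; exact: derivable_cst.
apply/smooth_uptoS; split=> [|p]; last by rewrite pd_cst.
exact: smooth_uptoW0 (IH c).
Qed.

Lemma smooth_uptoD n f h :
  smooth_upto n f -> smooth_upto n h -> smooth_upto n (f + h).
Proof.
elim: n f h => [|n IH] f h fs hs.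
  move: fs hs => /smooth_upto0[fc fd] /smooth_upto0[hc hd].
  apply/smooth_upto0; split=> [x|p x]; last exact: derivableD.
  by apply: continuousD; [exact: fc|exact: hc].
apply/smooth_uptoS; split=> [|p].
  by have := IH _ _ (smooth_uptoW fs) (smooth_uptoW hs); exact: smooth_uptoW0.
have [f0 h0] := (smooth_uptoW0 fs, smooth_uptoW0 hs).
rewrite (pdD p f0 h0); move: fs hs => /smooth_uptoS[_ fs] /smooth_uptoS[_ hs].
exact: IH (fs p) (hs p).
Qed.

Lemma smooth_uptoM n f h :
  smooth_upto n f -> smooth_upto n h -> smooth_upto n (f * h).
Proof.
elim: n f h => [|n IH] f h fs hs.
  move: fs hs => /smooth_upto0[fc fd] /smooth_upto0[hc hd].
  apply/smooth_upto0; split=> [x|p x]; last exact: derivableM.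
  by apply: continuousM; [exact: fc|exact: hc].
have [f0 h0] := (smooth_uptoW0 fs, smooth_uptoW0 hs).
have [fn hn] := (smooth_uptoW fs, smooth_uptoW hs).
apply/smooth_uptoS; split=> [|p]; first exact: smooth_uptoW0 (IH _ _ fn hn).
rewrite (pdM p f0 h0); move: fs hs => /smooth_uptoS[_ fs] /smooth_uptoS[_ hs].
exact: (smooth_uptoD (IH _ _ fn (hs p)) (IH _ _ hn (fs p))).
Qed.

Lemma smooth_upto_expR n W : smooth_upto n W -> smooth_upto n (expR \o W).
Proof.
elim: n W => [|n IH] W Ws.
  move: Ws => /smooth_upto0[Wc Wd].
  apply/smooth_upto0; split=> [x|p x].
    by apply: continuous_comp; [exact: Wc|exact: continuous_expR].
  by have [] := is_derive_expR_comp (Wd p x).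
have [W0 Wn] := (smooth_uptoW0 Ws, smooth_uptoW Ws).
apply/smooth_uptoS; split=> [|p]; first exact: smooth_uptoW0 (IH _ Wn).
rewrite (pd_expR p W0); move: Ws => /smooth_uptoS[_ Ws].
by apply: smooth_uptoM; [exact: Ws|exact: IH].
Qed.

Lemma smooth_cst (c : R) : smooth (fun=> c : R).
Proof. by apply/smoothP => n; exact: smooth_upto_cst. Qed.

Lemma smoothD f h : smooth f -> smooth h -> smooth (f + h).
Proof.
by move=> /smoothP fs /smoothP hs; apply/smoothP => n; exact: smooth_uptoD.
Qed.

Lemma smoothM f h : smooth f -> smooth h -> smooth (f * h).
Proof.
by move=> /smoothP fs /smoothP hs; apply/smoothP => n; exact: smooth_uptoM.
Qed.

Lemma smooth_expR W : smooth W -> smooth (expR \o W).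
Proof. by move=> /smoothP Ws; apply/smoothP => n; exact: smooth_upto_expR. Qed.

Lemma smoothN f : smooth f -> smooth (- f).
Proof.
move=> fs; rewrite (_ : - f = (fun=> -1 : R) * f); last first.
  by apply/funext => x /=; rewrite [RHS]mulN1r.
exact: smoothM (smooth_cst _) fs.
Qed.

Lemma is_derive_theta p x :
  is_derive x (delta_mx 0 p) (@theta R) (p == 0)%:R.
Proof.
have D : (fun h : R =>
      h^-1 *: ((@theta R \o shift x) (h *: delta_mx 0 p) - theta x)) @ 0^'
    --> ((p == 0)%:R : R).
  (* [theta] is linear, so for [t != 0] the difference quotient is exactly its limit. *)
  apply: cvg_near_cst; near=> t.
  rewrite /theta /= !mxE /= addrK [_ *: _]mulKf; first by rewrite eq_sym.
  by near: t; exact: nbhs_dnbhs_neq.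
by split; [apply/cvg_ex; exists (p == 0)%:R|exact/cvg_lim].
Unshelve. all: by end_near. Qed.

Lemma pd_theta p : pd p (@theta R) = (fun=> (p == 0)%:R).
Proof. by apply/funext => x; have [_] := is_derive_theta p x. Qed.

Lemma smooth_theta : smooth (@theta R).
Proof.
have s0 : smooth_upto 0 (@theta R).
  apply/smooth_upto0; split => [|p x]; first exact: coord_continuous.
  by have [] := is_derive_theta p x.
apply/smoothP => -[//|n]; apply/smooth_uptoS; split => // p.
by rewrite pd_theta; exact: smooth_upto_cst.
Qed.

Lemma is_derive_line f x v (t : R) : derivable f (t *: v + x) v ->
  is_derive t 1 (fun s : R => f (s *: v + x)) ('D_v f (t *: v + x)).
Proof.
move=> fd.
have E : (fun h : R =>
      h^-1 *: ((f \o shift (t *: v + x)) (h *: v) - f (t *: v + x))) =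
    (fun h : R => h^-1 *: (((fun s : R => f (s *: v + x)) \o shift t)
      (h *: (1 : R)) - f (t *: v + x))).
  by apply/funext => h /=; rewrite [_%:A]mulr1 scalerDl addrA.
split; first by rewrite /derivable -E.
by rewrite /derive -E.
Qed.

(** Two uses of the mean value theorem: in direction [p] for the increment [F] of [f] along [q],
    then in direction [q] for [pd p f]. *)
Lemma second_difference f p q x (d : R) : smooth f -> 0 < d ->
  exists s t : R, [/\ 0 < s < d, 0 < t < d &
    f (d *: delta_mx 0 p + (d *: delta_mx 0 q + x)) - f (d *: delta_mx 0 p + x)
    - (f (d *: delta_mx 0 q + x) - f x)
    = pd q (pd p f) (t *: delta_mx 0 q + (s *: delta_mx 0 p + x)) * d * d].
Proof.
move=> fs d0.
set ep := delta_mx 0 p; set fq := delta_mx 0 q.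
pose F (s : R) := f (s *: ep + (d *: fq + x)) - f (s *: ep + x).
have dF (s : R) : is_derive s 1 F
    (pd p f (s *: ep + (d *: fq + x)) - pd p f (s *: ep + x)).
  by apply: is_deriveB; apply: is_derive_line; exact: smooth_derivable.
have cF (g g' : R -> R) (I : set R) :
    (forall s : R, is_derive s 1 g (g' s)) -> {within I, continuous g}.
  move=> dg; apply: continuous_subspaceT => s.
  by apply/differentiable_continuous/derivable1_diffP; have [] := dg s.
have [s + sE] := MVT d0 (fun s _ => dF s) (cF _ _ _ dF).
rewrite in_itv /= => sd.
pose G (t : R) := pd p f (t *: fq + (s *: ep + x)).
have dG (t : R) : is_derive t 1 G (pd q (pd p f) (t *: fq + (s *: ep + x))).
  by apply: is_derive_line; apply: smooth_derivable; exact: smooth_pd.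
have [t + tE] := MVT d0 (fun t _ => dG t) (cF _ _ _ dG).
rewrite in_itv /= => td.
exists s, t; split => //.
move: sE tE; rewrite /F /G !scale0r !add0r !subr0 => -> <-.
by rewrite addrCA.
Qed.

(** Schwarz's theorem: the second difference is symmetric in [p] and [q], so the two mixed partials
    take a common value at two points near [x]; by continuity they differ at [x] by less than any
    [e]. *)
Lemma pdC f p q : smooth f -> pd p (pd q f) = pd q (pd p f).
Proof.
move=> fs; apply/funext => x.
apply/eqP; rewrite -subr_eq0 -normr_le0; apply/ler_addgt0Pl => e e0.
rewrite addr0.
have e20 : 0 < e / 2 by rewrite divr_gt0.
have H r s : \forall y \near x, `|pd r (pd s f) x - pd r (pd s f) y| < e / 2.
  have /smooth_continuous/(_ x) : smooth (pd r (pd s f)).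
    by do 2!apply: smooth_pd.
  by move/cvgrPdist_lt; apply.
have [d /= d0 dP] : exists2 d : R, 0 < d & forall y, ball x d y ->
    `|pd p (pd q f) x - pd p (pd q f) y| < e / 2 /\
    `|pd q (pd p f) x - pd q (pd p f) y| < e / 2.
  have HH := filterI (H p q) (H q p).
  have /nbhs_ballP[d d0 dP] : nbhs x (fun y =>
      `|pd p (pd q f) x - pd p (pd q f) y| < e / 2 /\
      `|pd q (pd p f) x - pd q (pd p f) y| < e / 2) by exact: HH.
  by exists d.
(* Two displacements shorter than [d / 3] stay inside the ball of radius [d]. *)
pose k := d / 3.
have k0 : 0 < k by rewrite divr_gt0.
have B (r r' : 'I_3) (s t : R) : 0 < s < k -> 0 < t < k ->
    ball x d (t *: delta_mx 0 r + (s *: delta_mx 0 r' + x)).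
  move=> /andP[s0 sk] /andP[t0 tk]; rewrite -ball_normE /ball_ /=.
  rewrite distrC addrA addrK (le_lt_trans (ler_normD _ _))//.
  have n1 (u : 'I_3) : `|delta_mx 0 u : 'rV[R]_3| <= 1.
    rewrite /Num.norm /= mx_normrE; apply/bigmax_leP; split => // i _.
    by rewrite mxE; case: (_ && _); rewrite ?normr1 ?normr0.
  rewrite !normrZ (gtr0_norm s0) (gtr0_norm t0).
  have := ler_wpM2l (ltW s0) (n1 r'); have := ler_wpM2l (ltW t0) (n1 r).
  by rewrite /k in sk tk *; lra.
have [s1 [t1 [s1k t1k E1]]] := second_difference p q x fs k0.
have [s2 [t2 [s2k t2k E2]]] := second_difference q p x fs k0.
have [_] := dP _ (B q p _ _ s1k t1k).
have [+ _] := dP _ (B p q _ _ s2k t2k).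
move: E1 E2; rewrite (addrCA (k *: delta_mx 0 q)).
move: (f _) (f _) (f _) (f _) => u1 u2 u3 u4.
move: (pd q _ _) (pd p _ _) (pd p _ x) (pd q _ x) => c1 c2 c3 c4.
move=> E1 E2.
(* Both equal the same second difference divided by [k * k]. *)
have -> : c1 = c2.
  apply: (mulIf (lt0r_neq0 k0)); apply: (mulIf (lt0r_neq0 k0)).
  by rewrite -E1 -E2; ring.
rewrite !ltr_norml => /andP[d1 d2] /andP[d3 d4].
rewrite ler_norml; apply/andP; split; lra.
Qed.

End SmoothFunctions.

(** * Positivity of the mass of [exp (- V)] *)

(** By continuity [V <= V 0 + 1] on a small cube around the origin, so the integral is at least
    [exp (- (V 0 + 1))] times the volume of that cube. *)
Lemma mass_gt0 {R : realType} (V : 'rV[R]_3 -> R) :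
  continuous V -> (0 < mass V)%E.
Proof.
move=> Vc.
have [d d0 dP] : exists2 d : R, 0 < d & forall y, ball 0 d y -> V y < V 0 + 1.
  have /cvgrPdist_lt/(_ 1 ltr01)/nbhs_ballP[d d0 dP] := Vc 0.
  exists d => // y /dP; rewrite ltr_norml => /andP[+ _]; lra.
(* Row vectors carry the maximum norm, so the ball of radius [d] is this cube. *)
pose I := `]- d, d[%classic : set R.
have mI : measurable I by exact: measurable_itv.
pose B := (I `*` I) `*` I.
have mB : measurable B by do 2?[apply: measurableX => //].
have BE (t : R * R * R) : B t -> V (vec3 t) <= V 0 + 1.
  move=> [[t1 t2] t3]; apply/ltW/dP; rewrite -ball_normE /ball_ /= sub0r normrN.
  rewrite /Num.norm /= mx_normrE; apply/bigmax_ltP; split => // -[i j] _ /=.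
  rewrite mxE; move: t1 t2 t3; rewrite /I /= !in_itv /= -!ltr_norml.
  by case: j => -[|[|[|//]]].
have muI : lebesgue_measure I = (2 * d)%:E.
  rewrite /I lebesgue_measure_itv /= lte_fin gtrN // -EFinB; congr EFin; ring.
have muII : (@lebesgue_measure R \x @lebesgue_measure R)%E (I `*` I) =
    ((2 * d) ^+ 2)%:E.
  by rewrite product_measure1E// expr2 EFinM -muI.
have muB : lebesgue3 B = ((2 * d) ^+ 3)%:E.
  rewrite /lebesgue3 /B product_measure1E//; last exact: measurableX.
  by rewrite exprSr EFinM -muII -muI.
rewrite /mass.
apply: (@lt_le_trans _ _
    (\int[lebesgue3]_t (expR (- (V 0 + 1)) * \1_B t)%:E)%E).
  under eq_integral do rewrite EFinM.
  rewrite ge0_integralZl_EFin ?expR_ge0//; last first.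
    exact/measurable_EFinP/measurable_indic.
  rewrite integral_indic// setIT [X in (_ * X)%E]muB -EFinM lte_fin.
  by rewrite mulr_gt0 ?expR_gt0 // exprn_gt0 // mulr_gt0.
(* Each integral is a supremum over simple functions below the integrand; the pointwise bound makes
   the first family part of the second. *)
rewrite ge0_integralTE; last first.
  by move=> t; rewrite lee_fin mulr_ge0 ?expR_ge0.
rewrite [leRHS]ge0_integralTE; last first.
  by move=> t; rewrite lee_fin expR_ge0.
apply: ereal_sup_le => _ [h hle <-]; exists h => // t.
apply: le_trans (hle t) _; rewrite lee_fin indicE.
have [/set_mem tB|_] := boolP (t \in B); last by rewrite mulr0 expR_ge0.
by rewrite mulr1 ler_expR lerN2; exact: BE.
Qed.

(** * Tactics reducing differential identities to field identities at a point *)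

Lemma smooth_upto0W {R : realType} (u : 'rV[R]_3 -> R) :
  smooth u -> smooth_upto 0 u.
Proof. by move=> /smoothP. Qed.

Ltac smooth_tac := lazymatch goal with
  | |- smooth (pd _ _) => refine (smooth_pd _ _); smooth_tac
  | |- smooth (fun=> _) => exact: smooth_cst
  | |- smooth (@theta _) => exact: smooth_theta
  | |- smooth (_ + _) => refine (smoothD _ _); smooth_tac
  | |- smooth (_ * _) => refine (smoothM _ _); smooth_tac
  | |- smooth (- _) => refine (smoothN _); smooth_tac
  | |- smooth (_ \o _) => refine (smooth_expR _); smooth_tac
  | |- _ => assumption
  end.

Section SmoothRules.
Context {R : realType}.
Implicit Types (u h : 'rV[R]_3 -> R).

Lemma smooth_pdD p u h : smooth u -> smooth h -> pd p (u + h) = pd p u + pd p h.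
Proof. by move=> us hs; apply: pdD; exact: smooth_upto0W. Qed.

Lemma smooth_pdN p u : smooth u -> pd p (- u) = - pd p u.
Proof. by move=> us; apply: pdN; exact: smooth_upto0W. Qed.

Lemma smooth_pdM p u h : smooth u -> smooth h ->
  pd p (u * h) = u * pd p h + h * pd p u.
Proof. by move=> us hs; apply: pdM; exact: smooth_upto0W. Qed.

End SmoothRules.

Lemma onef_at {T : Type} {R : pzRingType} (x : T) : (1 : T -> R) x = 1.
Proof. by []. Qed.

Lemma zerof_at {T : Type} {R : pzRingType} (x : T) : (0 : T -> R) x = 0.
Proof. by []. Qed.

Ltac fct_at := repeat match goal with
  | |- context [@GRing.add _ ?u ?h ?y] => change ((u + h) y) with (u y + h y)
  | |- context [@GRing.mul _ ?u ?h ?y] => change ((u * h) y) with (u y * h y)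
  | |- context [@GRing.opp _ ?u ?y] => change ((- u) y) with (- u y)
  | |- context [@GRing.zero ?F ?y] => rewrite (zerof_at y)
  | |- context [@GRing.one ?F ?y] => rewrite (onef_at y)
  end; cbv beta.

(* Rewrites by purely syntactic matching: [rewrite] would compare candidate
   subterms up to unfolding of derivatives, which does not terminate in
   practice. *)
Ltac rewrite_syn l E :=
  let v := fresh "v" in let e := fresh "e" in
  generalize (E : l = _); generalize l; intros v e; subst v.

Ltac pd_push := repeat match goal with
  | |- context [pd ?p (@GRing.add ?F ?u ?h)] =>
    let Hu := constr:(ltac:(smooth_tac) : smooth u) in
    let Hh := constr:(ltac:(smooth_tac) : smooth h) in
    rewrite_syn (pd p (@GRing.add F u h)) (smooth_pdD p Hu Hh)
  | |- context [pd ?p (@GRing.mul ?F ?u ?h)] =>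
    let Hu := constr:(ltac:(smooth_tac) : smooth u) in
    let Hh := constr:(ltac:(smooth_tac) : smooth h) in
    rewrite_syn (pd p (@GRing.mul F u h)) (smooth_pdM p Hu Hh)
  | |- context [pd ?p (@GRing.opp ?F ?u)] =>
    let Hu := constr:(ltac:(smooth_tac) : smooth u) in
    rewrite_syn (pd p (@GRing.opp F u)) (smooth_pdN p Hu)
  end.

(** Values of derivatives become independent variables: the identities to be proved hold for
    arbitrary jets once mixed partials are sorted. *)
Ltac gen_pd := repeat match goal with
  | |- context [pd ?p ?u ?y] =>
    let d := fresh "d" in generalize (pd p u y); intro d
  end.

Ltac gen_at y := repeat match goal with
  | |- context [?u y] => let d := fresh "d" in generalize (u y); intro d
  end.

Ltac pd_ring := fct_at; gen_pd; by field.

Lemma sum3 {R : nmodType} (F : 'I_3 -> R) : \sum_(i < 3) F i = F 0 + F 1 + F 2.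
Proof.
rewrite !big_ord_recl big_ord0 addr0 addrA.
by congr (F _ + F _ + F _); exact: val_inj.
Qed.

Lemma sum2 {R : nmodType} (F : 'I_2 -> R) : \sum_(i < 2) F i = F 0 + F 1.
Proof.
rewrite !big_ord_recl big_ord0 addr0.
by congr (F _ + F _); exact: val_inj.
Qed.

#[local] Opaque pd smooth.

(** * The frame, the generator and [Gamma_2] on the displacement group *)

Section Displacement.
Context {R : realType}.
Variable beta : R.
Implicit Types (f g u h V : 'rV[R]_3 -> R) (w : 'rV[R]_3 -> 'cV[R]_3).
Local Notation a := (displ_a beta).

(** Written with operations of the ring of functions, so that the smoothness and product rules match
    it syntactically. *)
Definition exp_theta : 'rV[R]_3 -> R := expR \o ((fun=> beta) * @theta R).

Lemma smooth_exp_theta : smooth exp_theta.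
Proof. rewrite /exp_theta; smooth_tac. Qed.

Lemma pd_exp_theta p : pd p exp_theta = (fun=> beta * (p == 0)%:R) * exp_theta.
Proof.
rewrite /exp_theta pd_expR; last by apply: smooth_upto0W; smooth_tac.
rewrite pdM; [|by apply: smooth_upto0W; smooth_tac..].
by rewrite pd_cst pd_theta mulr0 addr0.
Qed.

Lemma displ_aE x (i : 'I_3) (k : 'I_2) : displ_a beta x i k =
  (nth [::] [:: [:: 1; 0; 0]; [:: 0; exp_theta x; 1]] k)`_i.
Proof. by rewrite !mxE. Qed.

Lemma A_vec0 w x : A_vec a 0 w x = w x 0 0.
Proof. by rewrite /A_vec !mxE sum3 !mxE /= !mul0r !addr0 mul1r. Qed.

Lemma A_vec1 w x : A_vec a 1 w x = exp_theta x * w x 1 0 + w x 2 0.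
Proof. by rewrite /A_vec !mxE sum3 !mxE /= !mul0r !add0r mul1r. Qed.

Definition frame2 u := exp_theta * pd 1 u + pd 2 u.

Lemma A0E u : A a 0 u = pd 0 u.
Proof. by apply/funext => x; rewrite /A A_vec0 mxE. Qed.

Lemma A1E u : A a 1 u = frame2 u.
Proof. by apply/funext => x; rewrite /A A_vec1 !mxE. Qed.

Lemma ZE g u : Z (displ_z g) u = - (g * pd 2 u).
Proof.
by apply/funext => x; rewrite /Z !mxE sum3 !mxE /= !mul0r !add0r mulNr.
Qed.

(** Computed as [a (a^T w)]: the components of [w] along [A_1] and [A_2] weight the two columns of
    [a]. *)
Lemma outer_aE w x : [/\ (outer a x *m w x) 0 0 = w x 0 0,
  (outer a x *m w x) 1 0 = exp_theta x * (exp_theta x * w x 1 0 + w x 2 0) &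
  (outer a x *m w x) 2 0 = exp_theta x * w x 1 0 + w x 2 0].
Proof.
by rewrite /outer -mulmxA; split; rewrite mxE sum2 !displ_aE
  -/(A_vec a 0 w x) -/(A_vec a 1 w x) A_vec0 A_vec1 /=
  ?mul0r ?mul1r ?add0r ?addr0.
Qed.

Lemma smooth_frame2 u : smooth u -> smooth (frame2 u).
Proof.
by move=> us; have es := smooth_exp_theta; rewrite /frame2; smooth_tac.
Qed.

Lemma pd1 p : pd p 1 = 0 :> ('rV[R]_3 -> R).
Proof. exact: pd_cst. Qed.

Lemma pd0 p : pd p 0 = 0 :> ('rV[R]_3 -> R).
Proof. exact: pd_cst. Qed.

Lemma pd_exp_theta0 : pd 0 exp_theta = (fun=> beta) * exp_theta.
Proof. by rewrite pd_exp_theta mulr1. Qed.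

Lemma pd_exp_theta1 : pd 1 exp_theta = 0.
Proof. by rewrite pd_exp_theta mulr0 mul0r. Qed.

Lemma pd_exp_theta2 : pd 2 exp_theta = 0.
Proof. by rewrite pd_exp_theta mulr0 mul0r. Qed.

Definition alphaE : (alpha a 0 0 = 1) * (alpha a 0 1 = 0) * (alpha a 0 2 = 0) *
  (alpha a 1 0 = 0) * (alpha a 1 1 = exp_theta) * (alpha a 1 2 = 1).
Proof. by do !split; apply/funext => x; rewrite /alpha !mxE. Qed.

Definition zetaE g : (zeta (displ_z g) 0 = 0) * (zeta (displ_z g) 1 = 0) *
  (zeta (displ_z g) 2 = - g).
Proof. by do !split; apply/funext => x; rewrite /zeta !mxE. Qed.

Lemma LE V u : smooth u -> L a V u =
  pd 0 (pd 0 u) + frame2 (frame2 u) - pd 0 V * pd 0 u - frame2 V * frame2 u.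
Proof.
move=> us; have es := smooth_exp_theta.
apply/funext => x; rewrite /L /div sum3.
have -> : (fun y => (outer a y *m grad u y) 0 0) = pd 0 u.
  by apply/funext => y; have [-> _ _] := outer_aE (grad u) y; rewrite mxE.
have -> : (fun y => (outer a y *m grad u y) 1 0) = exp_theta * frame2 u.
  by apply/funext => y; have [_ -> _] := outer_aE (grad u) y; rewrite !mxE.
have -> : (fun y => (outer a y *m grad u y) 2 0) = frame2 u.
  by apply/funext => y; have [_ _ ->] := outer_aE (grad u) y; rewrite !mxE.
have X2s := smooth_frame2 us.
(* The [k]-th summand carries the divergence of the field [A_k], which is zero. *)
have aga0 p : a_grad_a a x p 0 = 0.
  by rewrite mxE sum2 !sum3 !alphaE !(pd0, pd1) pd_exp_theta1 !mulr0 !addr0.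
rewrite /dot !sum3; have [-> -> ->] := outer_aE (grad u) x; rewrite !aga0 !mxE.
rewrite /frame2; pd_push; rewrite pd_exp_theta1 pd_exp_theta2; pd_ring.
Qed.

(** The carre du champ formula [L (u^2) = 2 u L u + 2 Gamma_1(u, u)], with doublings written as sums
    so that only operations known to [fct_at] occur. *)
Lemma L_sqr V u : smooth u -> L a V (u * u) =
  u * L a V u + u * L a V u + (pd 0 u * pd 0 u + frame2 u * frame2 u)
  + (pd 0 u * pd 0 u + frame2 u * frame2 u).
Proof.
move=> us; have es := smooth_exp_theta; rewrite !LE; [|smooth_tac..].
rewrite /frame2; pd_push; rewrite pd_exp_theta1 pd_exp_theta2.
apply/funext => x; pd_ring.
Qed.

Lemma LD V u h : smooth u -> smooth h -> L a V (u + h) = L a V u + L a V h.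
Proof.
move=> us hs; have es := smooth_exp_theta; rewrite !LE; [|smooth_tac..].
rewrite /frame2; pd_push; rewrite pd_exp_theta1 pd_exp_theta2.
apply/funext => x; pd_ring.
Qed.

Lemma Gamma1E u h : Gamma1 a u h = pd 0 u * pd 0 h + frame2 u * frame2 h.
Proof.
apply/funext => x; rewrite /Gamma1 /Gamma1_vec sum2.
by rewrite -/(A a 0 u x) -/(A a 1 u x) -/(A a 0 h x) -/(A a 1 h x) !A0E !A1E.
Qed.

(** [Gamma_1(f, f)] is a sum of two squares; [L_sqr] on each leaves commutators of [L] with the
    frame and squares of second derivatives. *)
Lemma Gamma2E V f : smooth f -> Gamma2 a V f =
  pd 0 f * (L a V (pd 0 f) - pd 0 (L a V f)) +
  frame2 f * (L a V (frame2 f) - frame2 (L a V f)) +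
  (pd 0 (pd 0 f) * pd 0 (pd 0 f) + frame2 (pd 0 f) * frame2 (pd 0 f) +
   pd 0 (frame2 f) * pd 0 (frame2 f) + frame2 (frame2 f) * frame2 (frame2 f)).
Proof.
move=> fs; have Xs := smooth_frame2 fs; apply/funext => x.
rewrite /Gamma2 !Gamma1E LD; [|smooth_tac..].
rewrite !L_sqr; [|smooth_tac..].
by fct_at; gen_at x; field.
Qed.

End Displacement.

(** * The density [rho] and its logarithmic derivative *)

Section RhoStar.
Context {R : realType}.
Variable V : 'rV[R]_3 -> R.
Hypotheses (Vs : smooth V) (Vm : (mass V < +oo)%E).

Lemma mass_fine_gt0 : 0 < fine (mass V).
Proof.
have m0 : (0 < mass V)%E by apply: mass_gt0; exact: smooth_continuous.
by rewrite fine_gt0// m0 Vm.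
Qed.

Lemma rho_star_gt0 x : 0 < rho_star V x.
Proof. by rewrite mulr_gt0 ?expR_gt0// invr_gt0 mass_fine_gt0. Qed.

Lemma rho_starE : rho_star V = (fun=> (fine (mass V))^-1) * (expR \o - V).
Proof. by []. Qed.

Lemma smooth_rho_star : smooth (rho_star V).
Proof. rewrite rho_starE; smooth_tac. Qed.

Lemma pd_rho_star p : pd p (rho_star V) = - (pd p V * rho_star V).
Proof.
have NVs : smooth (- V) by smooth_tac.
have Es : smooth (expR \o - V) by smooth_tac.
rewrite rho_starE smooth_pdM; [|exact: smooth_cst|exact: Es].
rewrite pd_expR; last exact: smooth_upto0W.
rewrite pd_cst smooth_pdN//; apply/funext => x; fct_at.
generalize (pd p V x) => d; generalize ((expR \o - V) x) => d'; ring.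
Qed.

Lemma ln_rho_starE :
  @ln R \o rho_star V = (fun=> ln (fine (mass V))^-1) - V.
Proof.
apply/funext => x /=; rewrite lnM ?posrE ?expR_gt0 ?invr_gt0 ?mass_fine_gt0//.
by rewrite expRK.
Qed.

Lemma pd_ln_rho_star p : pd p (@ln R \o rho_star V) = - pd p V.
Proof.
rewrite ln_rho_starE smooth_pdD; [|exact: smooth_cst|exact: smoothN].
by rewrite pd_cst smooth_pdN// add0r.
Qed.

End RhoStar.

(** * The form [Gamma_2^{z,rho}] in the frame *)

Section GammaZ.
Context {R : realType}.
Variable beta : R.
Variables (g V f : 'rV[R]_3 -> R).
Hypotheses (gs : smooth g) (Vs : smooth V) (Vm : (mass V < +oo)%E)
  (fs : smooth f).
Local Notation a := (displ_a beta).
Local Notation z := (displ_z g).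
Local Notation e := (exp_theta beta).
Local Notation Y := (frame2 beta).
Local Notation rho := (rho_star V).

Let es : smooth e. Proof. exact: smooth_exp_theta. Qed.

Lemma outer_a_entry i j : (fun y => outer a y i j) =
  alpha a 0 i * alpha a 0 j + alpha a 1 i * alpha a 1 j.
Proof. by apply/funext => y; fct_at; rewrite mxE sum2 /alpha !mxE. Qed.

Lemma outer_z_entry i j : (fun y => outer z y i j) = zeta z i * zeta z j.
Proof. by apply/funext => y; fct_at; rewrite mxE big_ord1 /zeta !mxE. Qed.

Lemma grad_quadE (M : 'rV[R]_3 -> 'M[R]_3) h p y :
  let m i j := pd p (fun x => M x i j) y in
  grad_quad M h y p 0 =
  pd 0 h y * (m 0 0 * pd 0 h y + m 0 1 * pd 1 h y + m 0 2 * pd 2 h y) +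
  pd 1 h y * (m 1 0 * pd 0 h y + m 1 1 * pd 1 h y + m 1 2 * pd 2 h y) +
  pd 2 h y * (m 2 0 * pd 0 h y + m 2 1 * pd 1 h y + m 2 2 * pd 2 h y).
Proof. by rewrite mxE /dot sum3 !mxE !sum3 !mxE. Qed.

Lemma grad_quad_a2 y : grad_quad (outer a) f y 2 0 = 0.
Proof.
rewrite grad_quadE !outer_a_entry !alphaE.
rewrite !(mulr0, mul0r, addr0, add0r, mulr1, mul1r).
rewrite !pd0 !pd1 smooth_pdM// pd_exp_theta2; pd_ring.
Qed.

(** The only nonzero entry of [z z^T] is [g^2], at [(y, y)]; this is its [p]-th derivative times
    [(d_y f)^2]. *)
Definition grad_quad_z p := (g * pd p g + g * pd p g) * (pd 2 f * pd 2 f).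

Lemma grad_quad_zE p : (fun y => grad_quad (outer z) f y p 0) = grad_quad_z p.
Proof.
apply/funext => y.
rewrite grad_quadE !outer_z_entry !zetaE.
rewrite !(mulr0, mul0r) mulrNN !pd0 smooth_pdM// /grad_quad_z; pd_ring.
Qed.

Lemma trmx_z_mul x (v : 'cV[R]_3) : ((z x)^T *m v) 0 0 = - g x * v 2 0.
Proof. by rewrite mxE sum3 !mxE /= !mul0r !add0r. Qed.

Lemma outer_zE (w : 'rV[R]_3 -> 'cV[R]_3) x (p : 'I_3) :
  (outer z x *m w x) p 0 = z x p 0 * (- g x * w x 2 0) :> R.
Proof. by rewrite /outer -mulmxA mxE big_ord1 trmx_z_mul. Qed.

(** Every component of [z z^T w] is a multiple of the [y] component of [w], and that component
    vanishes by [grad_quad_a2]. *)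
Lemma div_rho_zz x :
  div_rho rho (fun y => outer z y *m grad_quad (outer a) f y) x = 0.
Proof.
have E (p : 'I_3) :
    (fun y => (rho y *: (outer z y *m grad_quad (outer a) f y)) p 0) = 0.
  apply/funext => y; rewrite mxE (outer_zE (grad_quad (outer a) f)).
  by rewrite grad_quad_a2 !mulr0.
by rewrite /div_rho /div sum3 !E !pd0 !addr0 mulr0.
Qed.

(** Since the fields [A_i] are divergence free and [A_i rho = - rho A_i V], the weighted divergence
    of [a a^T w] is the sum over [i] of [A_i - A_i V] applied to the component of [w] along
    [A_i]. *)
Lemma div_rho_aa x :
  div_rho rho (fun y => outer a y *m grad_quad (outer z) f y) x =
  (pd 0 (grad_quad_z 0) + Y (e * grad_quad_z 1 + grad_quad_z 2)
   - pd 0 V * grad_quad_z 0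
   - Y V * (e * grad_quad_z 1 + grad_quad_z 2)) x.
Proof.
have w p y : grad_quad (outer z) f y p 0 = grad_quad_z p y.
  by rewrite -grad_quad_zE.
pose F p y := (rho y *: (outer a y *m grad_quad (outer z) f y)) p 0.
transitivity ((rho x)^-1 * (pd 0 (F 0) x + pd 1 (F 1) x + pd 2 (F 2) x)).
  by rewrite /div_rho /div sum3.
have oE y := outer_aE beta (grad_quad (outer z) f) y.
have -> : F 0 = rho * grad_quad_z 0.
  by apply/funext => y; rewrite /F mxE; have [-> _ _] := oE y; rewrite w.
have -> : F 1 = rho * (e * (e * grad_quad_z 1 + grad_quad_z 2)).
  by apply/funext => y; rewrite /F mxE; have [_ -> _] := oE y; rewrite !w.
have -> : F 2 = rho * (e * grad_quad_z 1 + grad_quad_z 2).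
  by apply/funext => y; rewrite /F mxE; have [_ _ ->] := oE y; rewrite !w.
have rs := smooth_rho_star Vs.
have ws p : smooth (grad_quad_z p) by (rewrite /grad_quad_z; smooth_tac).
have ws0 := ws 0; have ws1 := ws 1; have ws2 := ws 2.
rewrite /frame2; pd_push.
rewrite !pd_rho_star// pd_exp_theta1 pd_exp_theta2; fct_at.
move: (grad_quad_z 0 x) (grad_quad_z 1 x) (grad_quad_z 2 x) => w0 w1 w2.
(* The factor [1 / rho] cancels only because the mass is positive and finite. *)
have := lt0r_neq0 (rho_star_gt0 Vs Vm x).
move: (rho x) => r r0.
gen_pd.
by field.
Qed.

Lemma Gamma2zE x : Gamma2z a z V rho f x =
  (Z z f * (L a V (Z z f) - Z z (L a V f)) +
   (pd 0 (Z z f) * pd 0 (Z z f) + Y (Z z f) * Y (Z z f)) -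
   (pd 0 (grad_quad_z 0) + Y (e * grad_quad_z 1 + grad_quad_z 2)
   - pd 0 V * grad_quad_z 0
   - Y V * (e * grad_quad_z 1 + grad_quad_z 2))) x.
Proof.
have Zs : smooth (Z z f) by (rewrite ZE; smooth_tac).
rewrite /Gamma2z div_rho_zz div_rho_aa.
have -> : Gamma1z z f f = Z z f * Z z f by [].
have -> : Gamma1z z (L a V f) f x = Z z (L a V f) x * Z z f x by [].
by rewrite L_sqr//; fct_at; gen_at x; field.
Qed.

End GammaZ.

(** * The quadratic forms of [Q] and [P] as sums of squares *)

Lemma sum_mxtens {V : nmodType} m n (F : 'I_(m * n) -> V) :
  \sum_u F u = \sum_(p < m) \sum_(q < n) F (mxtens_index (p, q)).
Proof.
rewrite (reindex (@mxtens_index m n)) /=; last first.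
  exists (@mxtens_unindex m n) => ? _;
    by rewrite (mxtens_indexK, mxtens_unindexK).
by rewrite pair_bigA; apply: eq_bigr => -[].
Qed.

Lemma gramE {R : realType} m n (M : 'M[R]_(m, n)) v :
  gram M v = \sum_i (\sum_u M i u * v u 0) * (\sum_u M i u * v u 0).
Proof.
rewrite /gram -!mulmxA mulmxA -trmx_mul mxE.
by apply: eq_bigr => i _; rewrite !mxE.
Qed.

Section Hessian.
Context {R : realType}.
Variables (beta : R) (g V f : 'rV[R]_3 -> R) (x : 'rV[R]_3).
Local Notation a := (displ_a beta).
Local Notation z := (displ_z g).
Local Notation e := (exp_theta beta).

Definition entry (v : 'cV[R]_(3 * 3)) p q := v (mxtens_index (p, q)) 0.

(** Row [(i, k)] of [Q] contracts the 3 by 3 array [v] with [A_i] in the first index and [A_k] in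
    the second. *)
Lemma gram_Q v : gram (Qmx a x) v =
  entry v 0 0 ^+ 2 + (e x * entry v 0 1 + entry v 0 2) ^+ 2 +
  (e x * entry v 1 0 + entry v 2 0) ^+ 2 +
  (e x * (e x * entry v 1 1 + entry v 1 2) +
   (e x * entry v 2 1 + entry v 2 2)) ^+ 2.
Proof.
have E i k : \sum_u Qmx a x (mxtens_index (i, k)) u * v u 0 =
    \sum_(p < 3) \sum_(q < 3) alpha a i p x * alpha a k q x * entry v p q.
  rewrite sum_mxtens; apply: eq_bigr => p _; apply: eq_bigr => q _.
  by rewrite mxE !mxtens_indexK.
rewrite gramE sum_mxtens !sum2 !E !sum3 !alphaE; fct_at.
ring.
Qed.

(** As [z] points in the [y] direction, only the entries of [v] with first index [y] are seen; hence
    [entry_Lambda2E] lists just those. *)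
Lemma gram_P v : gram (Pmx a z x) v =
  g x ^+ 2 * (entry v 2 0 ^+ 2 + (e x * entry v 2 1 + entry v 2 2) ^+ 2).
Proof.
have E k : \sum_u Pmx a z x k u * v u 0 =
    \sum_(p < 3) \sum_(q < 3) zeta z p x * alpha a k q x * entry v p q.
  rewrite sum_mxtens; apply: eq_bigr => p _; apply: eq_bigr => q _.
  by rewrite mxE !mxtens_indexK.
rewrite gramE sum2 !E !sum3 !alphaE !zetaE; fct_at.
ring.
Qed.

Lemma entryD v w p q : entry (v + w) p q = entry v p q + entry w p q.
Proof. exact: mxE. Qed.

Lemma entry_X p q : entry (Xvec f x) p q = pd p (pd q f) x.
Proof. by rewrite /entry mxE mxtens_indexK. Qed.

Local Notation l1 := (entry (Lambda1 beta f x)).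
Local Notation l2 := (entry (Lambda2 beta g f x)).

Definition entry_Lambda1E :
  (l1 0 0 = 0) * (l1 0 1 = beta * pd 1 f x) * (l1 0 2 = beta * pd 2 f x / 2) *
  (l1 1 0 = beta * pd 1 f x) * (l1 1 1 = 0) * (l1 1 2 = 0) *
  (l1 2 0 = beta * pd 2 f x / 2) * (l1 2 1 = 0) *
  (l1 2 2 = - (beta * pd 0 f x)).
Proof. by rewrite /entry; do !split; rewrite mxE. Qed.

Definition entry_Lambda2E :
  (l2 2 0 = lambda6 beta g f x) * (l2 2 1 = 0) *
  (l2 2 2 = lambda9 beta g f x).
Proof. by rewrite /entry; do !split; rewrite mxE. Qed.

End Hessian.

Ltac sum_expand := repeat match goal with
  | |- context [@bigop.body ?T ?I ?idx ?r ?F] => lazymatch F with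
    | (fun i : 'I_3 => @BigBody _ _ i _ true (@?G i)) =>
      rewrite_syn (@bigop.body T I idx r F) (sum3 G)
    | (fun i : 'I_2 => @BigBody _ _ i _ true (@?G i)) =>
      rewrite_syn (@bigop.body T I idx r F) (sum2 G)
    end; cbv beta
  end.

Ltac pd_swap p q u :=
  let Hu := constr:(ltac:(smooth_tac) : smooth u) in
  rewrite_syn (pd p (pd q u)) (pdC p q Hu).

(** Normal form with smaller indices outermost, so that equal mixed partials become the same
    variable. *)
Ltac pd_sort := repeat match goal with
  | |- context [pd 1 (pd 0 ?u)] => pd_swap (1 : 'I_3) (0 : 'I_3) u
  | |- context [pd 2 (pd 0 ?u)] => pd_swap (2 : 'I_3) (0 : 'I_3) u
  | |- context [pd 2 (pd 1 ?u)] => pd_swap (2 : 'I_3) (1 : 'I_3) u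
  end.

(* [cbv] expands these sums at once; rewriting the nested big operators one by
   one is much slower. *)
Definition add2 {R : nmodType} (F : 'I_2 -> R) := F 0 + F 1.
Definition add3 {R : nmodType} (F : 'I_3 -> R) := F 0 + F 1 + F 2.

Lemma sum2333 {R : nmodType} (G : 'I_2 -> 'I_3 -> 'I_3 -> 'I_3 -> R) :
  \sum_(i < 2) \sum_(q < 3) \sum_(r < 3) \sum_(s < 3) G i q r s =
  add2 (fun i => add3 (fun q => add3 (fun r => add3 (fun s => G i q r s)))).
Proof. by sum_expand. Qed.

Lemma sum23333 {R : nmodType} (G : 'I_2 -> 'I_3 -> 'I_3 -> 'I_3 -> 'I_3 -> R) :
  \sum_(i < 2) \sum_(p < 3) \sum_(q < 3) \sum_(r < 3) \sum_(s < 3) G i p q r s =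
  add2 (fun i => add3 (fun p => add3 (fun q => add3 (fun r => add3 (fun s =>
    G i p q r s))))).
Proof.
rewrite sum2 /add2; congr (_ + _);
  by rewrite sum3 /add3; congr (_ + _ + _); sum_expand.
Qed.

Lemma sqr_colE {R : realType} m (u : 'cV[R]_m) :
  (u^T *m u) 0 0 = \sum_i u i 0 * u i 0.
Proof. by rewrite mxE; apply: eq_bigr => i _; rewrite mxE. Qed.

(** * The curvature tensors and the Hessian term in coordinates *)

Section Tensors.
Context {R : realType}.
Variables (beta : R) (g V f : 'rV[R]_3 -> R).
Hypotheses (gs : smooth g) (Vs : smooth V) (Vm : (mass V < +oo)%E)
  (fs : smooth f).
Local Notation a := (displ_a beta).
Local Notation z := (displ_z g).
Local Notation e := (exp_theta beta).
Local Notation Y := (frame2 beta).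
Local Notation rho := (rho_star V).

Let es : smooth e. Proof. exact: smooth_exp_theta. Qed.

Definition driftE :
  ((fun y => drift a V y 0 0) = (fun=> - 2^-1) * pd 0 V) *
  ((fun y => drift a V y 1 0) = (fun=> - 2^-1) * (e * Y V)) *
  ((fun y => drift a V y 2 0) = (fun=> - 2^-1) * Y V).
Proof.
do !split; apply/funext => y; rewrite mxE;
  by have [E0 E1 E2] := outer_aE beta (grad V) y; rewrite ?E0 ?E1 ?E2 !mxE.
Qed.

(** The tensors contain derivatives of the drift, which need the equality of functions [driftE], as
    well as its values, which need this form. *)
Definition drift_atE x :
  (drift a V x 0 0 = - 2^-1 * pd 0 V x) *
  (drift a V x 1 0 = - 2^-1 * (e x * Y V x)) *
  (drift a V x 2 0 = - 2^-1 * Y V x).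
Proof.
do !split.
- exact: (congr1 (fun F => F x) driftE.1.1).
- exact: (congr1 (fun F => F x) driftE.1.2).
- exact: (congr1 (fun F => F x) driftE.2).
Qed.

(** [|Z f|^2 / g] is written as [g (d_y f)^2], which keeps the identity polynomial in [g]. *)
Lemma R_zbE x : R_zb a z V f x =
  (pd 0 (pd 0 g) x + e x ^+ 2 * pd 1 (pd 1 g) x + pd 2 (pd 2 g) x
   + 2 * e x * pd 1 (pd 2 g) x) * (g x * pd 2 f x ^+ 2)
  - (pd 0 g x * pd 0 V x + Y g x * Y V x) * pd 2 f x * (g x * pd 2 f x)
  + g x * pd 0 (pd 2 V) x * pd 0 f x * (g x * pd 2 f x)
  + g x * (e x * pd 1 (pd 2 V) x + pd 2 (pd 2 V) x) * Y f x
    * (g x * pd 2 f x).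
Proof.
rewrite /R_zb; cbv zeta beta.
sum_expand.
rewrite !alphaE !zetaE.
rewrite !(pd0, pd1).
rewrite !(pd_exp_theta0, pd_exp_theta1, pd_exp_theta2).
rewrite_syn (drift a V x 0 0) (drift_atE x).1.1.
rewrite_syn (drift a V x 1 0) (drift_atE x).1.2.
rewrite_syn (drift a V x 2 0) (drift_atE x).2.
rewrite !driftE.
rewrite !ZE /frame2.
pd_push.
rewrite ?(pd0, pd1, pd_cst).
rewrite ?(pd_exp_theta0, pd_exp_theta1, pd_exp_theta2).
pd_sort.
pd_ring.
Qed.

(** Terms that differentiate [a] along [z] vanish because [a] does not depend on [y]; the last two
    sums of [R_rho] remain, with [A_i (log rho) = - A_i V]. *)
Lemma R_rhoE x : R_rho a z rho f x =
  - 2 * (pd 0 (pd 0 g) x + e x ^+ 2 * pd 1 (pd 1 g) x + pd 2 (pd 2 g) x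
         + 2 * e x * pd 1 (pd 2 g) x) * (g x * pd 2 f x ^+ 2)
  + 2 * (pd 0 g x * pd 0 V x + Y g x * Y V x) * (g x * pd 2 f x ^+ 2)
  - 2 * (pd 0 g x ^+ 2 + Y g x ^+ 2) * pd 2 f x ^+ 2.
Proof.
rewrite /R_rho; cbv zeta beta.
rewrite !sum23333 !sum2333.
cbv beta delta [add2 add3].
rewrite !alphaE.
rewrite !zetaE.
rewrite !(pd0, pd1).
rewrite !(pd_exp_theta0, pd_exp_theta1, pd_exp_theta2).
rewrite !ZE !A0E !A1E /frame2.
rewrite !pd_ln_rho_star//.
pd_push.
rewrite ?(pd0, pd1, pd_cst).
rewrite ?(pd_exp_theta0, pd_exp_theta1, pd_exp_theta2).
pd_sort.
fct_at; gen_pd.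
move: (e x) (g x) => ? ?.
ring.
Qed.

(** Among the drift-free terms only the one with the second [theta] derivative of [e], equal to
    [beta^2 e], survives and gives the first summand; the drift gives the rest. *)
Lemma R_abE x : let b := beta in let E := e x in
  R_ab a V f x =
  b ^+ 2 * E * pd 1 f x * Y f x
  + pd 0 f x * (pd 0 (pd 0 V) x * pd 0 f x + b * E * Y V x * pd 1 f x
    + (b * E * pd 1 V x + E * pd 0 (pd 1 V) x + pd 0 (pd 2 V) x) * Y f x)
  + Y f x * ((E * pd 0 (pd 1 V) x + pd 0 (pd 2 V) x) * pd 0 f x
    + (E ^+ 2 * pd 1 (pd 1 V) x + 2 * E * pd 1 (pd 2 V) x
       + pd 2 (pd 2 V) x) * Y f x
    - b * E * pd 0 V x * pd 1 f x).
Proof.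
move=> b E; rewrite /b /E; rewrite /R_ab; cbv zeta beta.
sum_expand.
rewrite !alphaE.
rewrite !(pd0, pd1).
rewrite !(pd_exp_theta0, pd_exp_theta1, pd_exp_theta2).
rewrite_syn (drift a V x 0 0) (drift_atE x).1.1.
rewrite_syn (drift a V x 1 0) (drift_atE x).1.2.
rewrite_syn (drift a V x 2 0) (drift_atE x).2.
rewrite !driftE.
rewrite !A0E !A1E /frame2.
pd_push.
rewrite ?(pd0, pd1, pd_cst).
rewrite ?(pd_exp_theta0, pd_exp_theta1, pd_exp_theta2).
pd_sort.
fct_at; gen_pd.
move: (e x) => ?.
by field.
Qed.

(** The only nonzero coefficient comes from [A_1] differentiating the entry [e]. *)
Lemma sqr_Dvec x : ((Dvec a f x)^T *m Dvec a f x) 0 0 =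
  (beta * e x * pd 1 f x) ^+ 2.
Proof.
have E i k : Dvec a f x (mxtens_index (i, k)) 0 =
    \sum_(p < 3) \sum_(r < 3) alpha a i p x * pd p (alpha a k r) x * pd r f x.
  by rewrite mxE mxtens_indexK.
rewrite sqr_colE sum_mxtens !sum2 !E; sum_expand.
rewrite !alphaE !(pd0, pd1) !(pd_exp_theta0, pd_exp_theta1, pd_exp_theta2).
pd_ring.
Qed.

Lemma sqr_Evec x : ((Evec a z f x)^T *m Evec a z f x) 0 0 =
  (pd 0 g x ^+ 2 + Y g x ^+ 2) * pd 2 f x ^+ 2.
Proof.
have E i : Evec a z f x i 0 =
    \sum_(p < 3) \sum_(r < 3) alpha a i p x * pd p (zeta z r) x * pd r f x.
  by rewrite mxE.
rewrite sqr_colE sum2 !E; sum_expand.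
rewrite !alphaE !zetaE !(pd0, pd1) /frame2; pd_push.
pd_ring.
Qed.

(** With [u = d_x f] and [v = d_y f], the [Lambda1] and [D] terms combine by [- 2 (b E u + b v /
    2)^2 + (b E u)^2 = - b^2 (E u + v)^2 + b^2 v^2 / 2]. After cancellation [lambda6] and [lambda9]
    are [- b Y f / g^2] and [b (d_theta f) / g^2], whence the [1 / g^2] part; [E^T E] gives the
    first line. *)
Lemma R_abGE x : g x != 0 -> let b := beta in let E := e x in
  R_abG a z V (Lambda1 b f) (Lambda2 b g f) f x =
  (pd 0 g x ^+ 2 + Y g x ^+ 2) * pd 2 f x ^+ 2
  - b ^+ 2 * (1 + 1 / g x ^+ 2) * (pd 0 f x ^+ 2 + Y f x ^+ 2)
  + b ^+ 2 / 2 * pd 2 f x ^+ 2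
  + b ^+ 2 * E * pd 1 f x * Y f x
  + b * E * Y V x * pd 1 f x * pd 0 f x
  + b * E * pd 1 V x * Y f x * pd 0 f x
  + pd 0 (pd 0 V) x * pd 0 f x ^+ 2
  + 2 * (E * pd 0 (pd 1 V) x + pd 0 (pd 2 V) x) * pd 0 f x * Y f x
  + (E ^+ 2 * pd 1 (pd 1 V) x + 2 * E * pd 1 (pd 2 V) x
     + pd 2 (pd 2 V) x) * Y f x ^+ 2
  - b * E * pd 0 V x * pd 1 f x * Y f x.
Proof.
move=> g0 b E; rewrite /b /E /R_abG R_abE sqr_Dvec sqr_Evec gram_Q gram_P.
rewrite !entry_Lambda1E !entry_Lambda2E /lambda6 /lambda9 /dth /dx /dy.
rewrite !A1E /frame2.
fct_at; move: g0; gen_pd.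
move: (e x) (g x) => ? ? g0.
by field.
Qed.

(** Rows [(1,2)] and [(2,1)] of [Q] give equal squares by the symmetry of the Hessian and of
    [Lambda1], hence the doubled term. *)
Lemma Hess2E x : g x != 0 -> let b := beta in
  Hess2 a z (Lambda1 b f) (Lambda2 b g f) f x =
  pd 0 (pd 0 f) x ^+ 2 +
  (e x * pd 0 (pd 1 f) x + pd 0 (pd 2 f) x + b * (e x * pd 1 f x)
   + b * pd 2 f x / 2) ^+ 2 *+ 2
  + (e x ^+ 2 * pd 1 (pd 1 f) x + 2 * e x * pd 1 (pd 2 f) x
     + pd 2 (pd 2 f) x - b * pd 0 f x) ^+ 2
  + (g x * pd 0 (pd 2 f) x - b * Y f x / g x) ^+ 2
  + (g x * (e x * pd 1 (pd 2 f) x + pd 2 (pd 2 f) x) + b * pd 0 f x / g x) ^+ 2.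
Proof.
move=> g0 b; rewrite /b /Hess2 gram_Q gram_P !entryD !entry_X.
rewrite !entry_Lambda1E !entry_Lambda2E /lambda6 /lambda9 /dth /dx /dy.
rewrite !A1E /frame2.
pd_sort; fct_at; move: g0; gen_pd.
move: (e x) (g x) => ? ? g0.
by field.
Qed.

End Tensors.

(** * The Bochner identity *)

Section Bochner.
Context {R : realType}.
Variables (beta : R) (g V f : 'rV[R]_3 -> R).
Hypotheses (gs : smooth g) (Vs : smooth V) (Vm : (mass V < +oo)%E)
  (fs : smooth f).
Local Notation a := (displ_a beta).
Local Notation z := (displ_z g).
Local Notation e := (exp_theta beta).
Local Notation Y := (frame2 beta).
Local Notation rho := (rho_star V).

Let es : smooth e. Proof. exact: smooth_exp_theta. Qed.

(** Third derivatives of [f] cancel in the commutators, [Lambda1] and [Lambda2] absorb the terms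
    linear in second derivatives into the squares, and what is left is quadratic in the gradient of
    [f]. *)
Lemma bochner x : g x != 0 ->
  Gamma2 a V f x + Gamma2z a z V rho f x
  = Hess2 a z (Lambda1 beta f) (Lambda2 beta g f) f x
    + (R_abG a z V (Lambda1 beta f) (Lambda2 beta g f) f x
       + R_zb a z V f x + R_rho a z rho f x).
Proof.
move=> g0; rewrite Hess2E// R_abGE// R_zbE// R_rhoE// Gamma2E// Gamma2zE//.
rewrite !ZE.
rewrite !LE; [|rewrite /frame2; smooth_tac..].
rewrite /grad_quad_z /frame2.
pd_push.
rewrite ?(pd0, pd1, pd_cst).
rewrite ?(pd_exp_theta0, pd_exp_theta1, pd_exp_theta2).
(* Replacing [pd 0 e] by [beta * e] under an outer derivative creates new products, hence a second
   round. *)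
pd_push.
rewrite ?(pd0, pd1, pd_cst).
rewrite ?(pd_exp_theta0, pd_exp_theta1, pd_exp_theta2).
pd_sort.
fct_at; move: g0; gen_pd.
move: (e x) (g x) => ? ? g0.
by field.
Qed.

End Bochner.

(** * Translation of the coordinate formulas into the stated form *)

Lemma normr_sqr {R : realType} (r : R) : `|r| ^+ 2 = r ^+ 2.
Proof. by rewrite real_normK// num_real. Qed.

Lemma Gamma1_vecE {R : realType} (beta : R) v w x :
  Gamma1_vec (displ_a beta) v w x =
  v x 0 0 * w x 0 0 +
  (exp_theta beta x * v x 1 0 + v x 2 0) *
  (exp_theta beta x * w x 1 0 + w x 2 0).
Proof. by rewrite /Gamma1_vec sum2 !A_vec0 !A_vec1. Qed.

Unset Implicit Arguments.

Theorem proposition4p3 (R : realType) (beta : R) (g V f : 'rV[R]_3 -> R)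
  (beta_ge0 : 0 <= beta) (beta_neq0 : beta != 0)
  (g_smooth : smooth g) (g_neq0 : forall x, g x != 0)
  (V_smooth : smooth V) (V_mass : (mass V < +oo)%E)
  (f_smooth : smooth f) :
  let a := displ_a beta in
  let z := displ_z g in
  let rho := rho_star V in
  let L1 := Lambda1 beta f in
  let L2 := Lambda2 beta g f in
  let A1 := A a 0 in
  let A2 := A a 1 in
  let Zf := Z z f in
  let e := fun x => expR (beta * theta x) in
  let Gloglog := Gamma1_vec a (grad_log g) (grad_log g) in
  forall x : 'rV[R]_3,
  [/\ Gamma2 a V f x + Gamma2z a z V rho f x
      = Hess2 a z L1 L2 f x
        + (R_abG a z V L1 L2 f x + R_zb a z V f x + R_rho a z rho f x),

      R_abG a z V L1 L2 f x
      = Gloglog x * Gamma1z z f f x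
        - beta ^+ 2 * (1 + 1 / g x ^+ 2) * Gamma1 a f f x
        + beta ^+ 2 / (2 * g x ^+ 2) * Gamma1z z f f x
        + beta ^+ 2 * e x * dx f x * A2 f x
        + beta * e x * A2 V x * dx f x * A1 f x
        + beta * e x * dx V x * A2 f x * A1 f x
        + dth (dth V) x * `|A1 f x| ^+ 2
        + 2 * (e x * dth (dx V) x + dth (dy V) x) * A1 f x * A2 f x
        + (e x ^+ 2 * dx (dx V) x + 2 * e x * dx (dy V) x + dy (dy V) x)
          * `|A2 f x| ^+ 2
        - beta * e x * A1 V x * dx f x * A2 f x,

      R_zb a z V f x
      = (dth (dth g) x + e x ^+ 2 * dx (dx g) x + dy (dy g) x
         + 2 * e x * dx (dy g) x) * (`|Zf x| ^+ 2 / g x)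
        - \sum_(k < 2) A a k (- g) x * A a k V x * dy f x * Zf x
        - g x * dth (dy V) x * A1 f x * Zf x
        - g x * (e x * dx (dy V) x + dy (dy V) x) * A2 f x * Zf x
    & R_rho a z rho f x
      = - 2 * (\sum_(l < 2) \sum_(p < 3) \sum_(q < 3)
            alpha a l p x * alpha a l q x * pd p (pd q (- g)) x)
          * dy f x * Zf x
        - 2 * Gamma1_vec a (grad (@ln R \o rho)) (grad_log g) x
          * `|Zf x| ^+ 2
        - 2 * Gloglog x * `|Zf x| ^+ 2].
Proof.
move=> a z rho L1 L2 A1 A2 Zf e Gll x; have gx0 := g_neq0 x.
have es := smooth_exp_theta beta.
have E : e x = exp_theta beta x by [].
(* The denominator cancels later against the factor [g^2] of [|Z f|^2]. *)
have G : Gll x = (pd 0 g x ^+ 2 + frame2 beta g x ^+ 2) / g x ^+ 2.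
  rewrite /Gll Gamma1_vecE !mxE /frame2; fct_at; move: gx0.
  gen_pd. move: (exp_theta beta x) (g x) => ? ? gx0. by field.
split; first exact: bochner.
- rewrite R_abGE// E G !normr_sqr /A1 /A2 /a !A0E !A1E Gamma1E.
  rewrite /Gamma1z ZE /frame2 /dth /dx /dy.
  fct_at; move: gx0; gen_pd; move: (exp_theta beta x) (g x) => ? ? gx0.
  by field.
- rewrite R_zbE// E normr_sqr sum2 /A1 /A2 /Zf /a !A0E !A1E ZE.
  rewrite /frame2 /dth /dx /dy.
  pd_push.
  fct_at; move: gx0; gen_pd; move: (exp_theta beta x) (g x) => ? ? gx0.
  by field.
- rewrite R_rhoE// G normr_sqr Gamma1_vecE !mxE /Zf ZE /a; sum_expand.
  rewrite !alphaE /frame2 /dy.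
  rewrite !pd_ln_rho_star//.
  pd_push. pd_sort.
  fct_at; move: gx0; gen_pd; move: (exp_theta beta x) (g x) => ? ? gx0.
  by field.
Qed.
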